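(* Let $L$ be a relational language all of whose relational symbols have arity at most $2$. Let $\mathbf{A}$ and $\mathbf{B}$ be finite $L$-structures which are F-cores. If $(\mathbf{A},\mathbf{B})$ is an F-gap, then $\mathbf{A}$ can be obtained from $\mathbf{B}$ by removal of one vertex; that is, there is a vertex $v$ of $\mathbf{B}$ such that $\mathbf{A}$ is isomorphic to the substructure of $\mathbf{B}$ induced on $B\setminus\{v\}$.
   Context: A language $L$ is a set of relational symbols $R\in L$, each associated with a positive natural number $a(R)$ called its arity. An $L$-structure is $\mathbf{A}=(A,(R_{\mathbf{A}};R\in L))$ where $R_{\mathbf{A}}\subseteq A^{a(R)}$ for each $R\in L$; $A$ is its vertex set, and $\mathbf{A}$ is finite if $A$ is finite. A full homomorphism $f:\mathbf{A}\to\mathbf{B}$ is a mapping $f:A\to B$ such that for every $R\in L$ and all $x_1,\ldots,x_{a(R)}\in A$: $(x_1,\ldots,x_{a(R)})\in R_{\mathbf{A}}$ if and only if $(f(x_1),\ldots,f(x_{a(R)}))\in R_{\mathbf{B}}$. Write $\mathbf{A}\leq^F\mathbf{B}$ if there exists a full homomorphism $\mathbf{A}\to\mathbf{B}$; this is a quasi-order on finite $L$-structures. Two structures are full-homomorphism equivalent if $\mathbf{A}\leq^F\mathbf{B}$ and $\mathbf{B}\leq^F\mathbf{A}$. A finite $L$-structure is an F-core if it has the minimum number of vertices among all finite $L$-structures in its equivalence class. A pair $(\mathbf{A},\mathbf{B})$ of F-cores is an F-gap if $\mathbf{A}$ and $\mathbf{B}$ are non-isomorphic, $\mathbf{A}\leq^F\mathbf{B}$,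 and every F-core $\mathbf{C}$ with $\mathbf{A}\leq^F\mathbf{C}\leq^F\mathbf{B}$ is isomorphic either to $\mathbf{A}$ or to $\mathbf{B}$. *)

(* Defs.v *)
From HB Require Import structures.
From mathcomp Require Import all_boot.

Set Implicit Arguments.
Unset Strict Implicit.
Unset Printing Implicit Defensive.

(* The set of symbols may be infinite. *)
Record language := Language {
  symbol :> Type;
  arity : symbol -> nat;
  arity_gt0 : forall R : symbol, 0 < arity R
}.

(* Finite L-structures; the structure with no vertices is allowed. *)
Record structure (L : language) := Structure {
  vertex :> finType;
  interp : forall R : L, {set (arity R).-tuple vertex}
}.

Definition full_hom (L : language) (A B : structure L) (f : A -> B) : Prop :=
  forall (R : L) (x : (arity R).-tuple A),
    x \in interp A R <-> map_tuple f x \in interp B R.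

Definition leF (L : language) (A B : structure L) : Prop :=
  exists f : A -> B, full_hom f.

Definition equivF (L : language) (A B : structure L) : Prop :=
  leF A B /\ leF B A.

Definition isomorphic (L : language) (A B : structure L) : Prop :=
  exists f : A -> B, bijective f /\ full_hom f.

Definition Fcore (L : language) (A : structure L) : Prop :=
  forall B : structure L, equivF A B -> #|A| <= #|B|.

Definition Fgap (L : language) (A B : structure L) : Prop :=
  [/\ Fcore A /\ Fcore B, ~ isomorphic A B, leF A B &
      forall C : structure L, Fcore C -> leF A C -> leF C B ->
        isomorphic C A \/ isomorphic C B].

Definition induced (L : language) (B : structure L) (S : {set B}) :
    structure L :=
  @Structure L {x : B | x \in S}
    (fun R => [set t : (arity R).-tuple {x : B | x \in S}
                 | map_tuple val t \in interp B R]).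

(* Main.v *)
(** An [F]-core [B] is a structure all of whose full endomorphisms are
    injective, so identifying two distinct vertices never gives a full
    endomorphism of [B]. Let [C] be the set of vertices [y] of [B] such that [A]
    maps fully into [B] avoiding [y]; it is nonempty. Suppose that for every
    [y] in [C] the structure [B - y] is not an [F]-core. Then two distinct
    vertices [s], [s'] are interchangeable in [B - y], and both are in [C],
    since [s] and [s'] can be exchanged in a full homomorphism avoiding [y].
    As [s] and [s'] are not interchangeable in [B] and arities are at most 2,
    they are told apart by their relations to [y], and by no other vertex. So
    each [y] in [C] separates two elements of [C] that no other [z] in [C]
    separates, which is impossible by Bondy's theorem on induced subsets. Hence
    some [B - y] with [y] in [C] is an [F]-core between [A] and [B]. *)
Require Import Defs.
From HB Require Import structures.
From mathcomp Require Import all_boot.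
From mathcomp Require Import boolp.

Set Implicit Arguments.
Unset Strict Implicit.
Unset Printing Implicit Defensive.

Section Bondy.
Variables (T K : finType) (f : T -> T -> K).

(** Padding by [None] outside [D] puts the traces for all [D] in one type. *)
Definition trace (D : {set T}) (u : T) : {ffun T -> option K} :=
  [ffun z => if z \in D then Some (f z u) else None].

Lemma eq_trace (D : {set T}) (u v : T) :
  trace D u = trace D v <-> {in D, forall z, f z u = f z v}.
Proof.
split=> [/ffunP Euv z zD | Euv]; first by have := Euv z; rewrite !ffunE zD => -[].
by apply/ffunP=> z; rewrite !ffunE; case: ifP => // zD; rewrite Euv.
Qed.

(* If every [y] in [C] separated some pair not separated by the other
   elements of [C], the number of traces would grow with each element of [D],
   giving more than [#|C|] traces on [C]. *)
Lemma bondy (C : {set T}) : C != set0 ->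
  exists2 y, y \in C & {in C &, forall u v,
    {in C, forall z, z != y -> f z u = f z v} -> f y u = f y v}.
Proof.
move=> C0; apply: contrapT => noy.
suff growth (n : nat) (D : {set T}) :
    #|D| = n -> D \subset C -> n < #|trace D @: C|.
  by have := growth _ C erefl (subxx _); rewrite ltnNge leq_imset_card.
elim: n D => [|n IHn] D cardD sDC.
  by rewrite card_gt0 imset_eq0.
have /card_gt0P [y yD] : 0 < #|D| by rewrite cardD.
have yC : y \in C := subsetP sDC y yD.
have cardDy : #|D :\ y| = n.
  by apply/eqP; rewrite -eqSS -cardD (cardsD1 y D) yD.
have sDyC : D :\ y \subset C := subset_trans (subsetDl _ _) sDC.
apply: leq_ltn_trans (IHn _ cardDy sDyC) _.
(* Forgetting the coordinate [y] maps the traces on [D] onto those on [D :\ y]. With equal counts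
   [p] would be injective on them, so elements agreeing on the rest of [C] would also agree at [y],
   against [noy]. *)
pose p (t : {ffun T -> option K}) := [ffun z => if z == y then None else t z].
have pE u : p (trace D u) = trace (D :\ y) u.
  by apply/ffunP=> z; rewrite !ffunE !inE; case: eqP.
have -> : trace (D :\ y) @: C = p @: (trace D @: C).
  by rewrite -imset_comp; apply: eq_imset => u /=; rewrite pE.
rewrite ltn_neqAle leq_imset_card andbT; apply/imset_injP => injp.
apply: noy; exists y => // u v uC vC Euv.
suff /eq_trace : trace D u = trace D v by apply.
apply: injp; rewrite ?imset_f // !pE; apply/eq_trace=> z.
by rewrite !inE => /andP [zy /(subsetP sDC) zC]; apply: Euv.
Qed.

End Bondy.

Section FullHom.
Variable L : language.
Implicit Types A B D : structure L.

Lemma full_hom_comp A B D (g : B -> D) (f : A -> B) :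
  full_hom g -> full_hom f -> full_hom (g \o f).
Proof.
move=> hg hf R x; rewrite hf hg.
by have -> : map_tuple g (map_tuple f x) = map_tuple (g \o f) x
  by apply: val_inj; rewrite /= map_comp.
Qed.

Lemma full_hom_cancel A B D (g : B -> D) (f : A -> B) :
  full_hom g -> full_hom (g \o f) -> full_hom f.
Proof.
move=> hg hgf R x; rewrite hgf hg.
by have -> : map_tuple g (map_tuple f x) = map_tuple (g \o f) x
  by apply: val_inj; rewrite /= map_comp.
Qed.

Lemma full_hom_val B (S : {set B}) :
  full_hom (val : induced S -> B).
Proof. by move=> R x; rewrite inE. Qed.

Lemma full_hom_eq A B (h : A -> B) (R : L) (x y : (arity R).-tuple A) :
  full_hom h -> map h x = map h y -> x \in interp A R <-> y \in interp A R.
Proof.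
move=> hh Exy; rewrite !hh.
by have -> : map_tuple h x = map_tuple h y by apply: val_inj.
Qed.

Lemma isomorphic_sym A B : isomorphic A B -> isomorphic B A.
Proof.
case=> f [[g fK gK] hf]; exists g; split; first by exists f.
apply: (full_hom_cancel hf) => R x.
have -> : map_tuple (f \o g) x = x; last by [].
by apply: val_inj; rewrite /= (eq_map gK) map_id.
Qed.

Lemma isomorphic_card A B : isomorphic A B -> #|A| = #|B|.
Proof. by case=> f [/bij_eq_card]. Qed.

(** Any section of [A] onto the image of [f] is again full, so [A] is equivalent to its image, which
    by minimality has as many vertices as [A]. *)
Lemma Fcore_full_hom_inj A B (f : A -> B) : Fcore A -> full_hom f -> injective f.
Proof.
move=> cA hf.
pose S := [set f a | a in [set: A]].
have fS a : f a \in S by apply: imset_f.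
pose f1 a : induced S := Sub (f a) (fS a).
have hf1 : full_hom f1.
  by apply: (full_hom_cancel (@full_hom_val B S)) => R x; rewrite hf.
have preim (y : induced S) : exists a, f1 a == y.
  case/imsetP: (valP y) => a _ Ey; exists a.
  by apply/eqP; apply: val_inj; rewrite /= -Ey.
pose g y := xchoose (preim y).
have gK y : f1 (g y) = y by apply/eqP/(xchooseP (preim y)).
have hg : full_hom g.
  apply: (full_hom_cancel hf1) => R x.
  have -> : map_tuple (f1 \o g) x = x; last by [].
  by apply: val_inj; rewrite /= (eq_map gK) map_id.
have leAS : #|A| <= #|induced S| by apply: cA; split; [exists f1 | exists g].
suff /imset_injP injf : #|f @: [set: A]| == #|[set: A]|.
  by move=> a b; apply: injf; rewrite inE.
by rewrite eqn_leq leq_imset_card cardsT; move: leAS; rewrite card_sig.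
Qed.

Lemma FcoreP A : Fcore A <-> forall h : A -> A, full_hom h -> injective h.
Proof.
split=> [cA h|injA B [[f hf] [g hg]]]; first exact: Fcore_full_hom_inj.
apply: (leq_card f); apply: (@inj_compr _ _ _ g).
exact/injA/full_hom_comp.
Qed.

Definition avoidable A B (y : B) : Prop :=
  exists2 f : A -> B, full_hom f & forall a, f a != y.

(* [c] ranges over all patterns of positions filled by [z], which makes
   [same_type z] an equivalence relation with no appeal to the arities. *)
Definition same_type B (z u v : B) : Prop :=
  forall (R : L) (c : (arity R).-tuple bool),
    map_tuple (fun b : bool => if b then z else u) c \in interp B R <->
    map_tuple (fun b : bool => if b then z else v) c \in interp B R.

Lemma avoidable_leF A B (y : B) : avoidable A y -> leF A (induced [set~ y]).
Proof.
case=> f hf fy.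
have fS a : f a \in [set~ y] by rewrite !inE.
exists (fun a => Sub (f a) (fS a) : induced [set~ y]).
by apply: (full_hom_cancel (@full_hom_val B [set~ y])) => R x; rewrite hf.
Qed.

Section Twins.
Variables (B : structure L) (y : B).
Variables (h : induced [set~ y] -> induced [set~ y]) (s s' : induced [set~ y]).
Hypotheses (hh : full_hom h) (hss' : h s = h s').

Lemma avoidable_twin A : avoidable A y -> s != s' -> avoidable A (val s).
Proof.
move=> /avoidable_leF [f hf] nss'.
pose f' a := if f a == s then s' else f a.
exists (val \o f'); last first.
  move=> a /=; rewrite (inj_eq val_inj) /f'.
  by case: (eqVneq (f a) s); rewrite // eq_sym.
apply: full_hom_comp; first exact: full_hom_val.
(* Redirecting [s] to [s'] is invisible after [h], and [h] reflects the relations. *)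
apply: (full_hom_cancel hh) => R x.
rewrite (full_hom_comp hh hf x).
have -> // : map_tuple (h \o f) x = map_tuple (h \o f') x.
apply: val_inj; apply: eq_map => a /=.
by rewrite /f'; case: eqP => // ->.
Qed.

Lemma same_type_twin (z : B) : z != y -> same_type z (val s) (val s').
Proof.
move=> zy R c.
have zS : z \in [set~ y] by rewrite !inE.
pose z1 : induced [set~ y] := Sub z zS.
pose t u := map_tuple (fun b : bool => if b then z1 else u) c.
have valt (u : induced [set~ y]) :
    map_tuple (fun b : bool => if b then z else val u) c = map_tuple val (t u).
  by apply: val_inj; rewrite /= -map_comp; apply: eq_map => -[].
rewrite !valt -!(@full_hom_val B [set~ y] R).
by apply: (full_hom_eq hh); rewrite /= -!map_comp; apply: eq_map => -[].
Qed.

(** Otherwise moving [s] to [s'] would be a non-injective full endomorphism of [B]. Tuples without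
    [s] are fixed; a tuple with both [s] and [y] has no other entry, by the arity bound, so
    [same_type y] applies; tuples without [y] live in [B] minus [y], where [h] identifies [s] and
    [s']. *)
Lemma not_same_type_twin :
    (forall R : L, arity R <= 2) -> Fcore B -> s != s' ->
  ~ same_type y (val s) (val s').
Proof.
move=> hL cB nss' Ess'.
pose m (x : B) := if x == val s then val s' else x.
have sy : val s != y by have := valP s; rewrite !inE.
suff /(Fcore_full_hom_inj cB) injm : full_hom m.
  have /injm /val_inj Es : m (val s) = m (val s').
    by rewrite /m eqxx (inj_eq val_inj); case: eqP.
  by rewrite Es eqxx in nss'.
move=> R t.
have [st|nst] := boolP (val s \in (t : seq B)); last first.
  have -> // : map_tuple m t = t.
  apply: val_inj => /=; apply: map_id_in => x xt.
  by rewrite /m; case: eqP => // Ex; rewrite -Ex xt in nst.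
have [yt|nyt] := boolP (y \in (t : seq B)).
  have tP x : x \in (t : seq B) -> x = val s \/ x = y.
    move=> xt; case: (eqVneq x (val s)) => [|xs]; first by left.
    case: (eqVneq x y) => [|xy]; first by right.
    have : uniq [:: x; val s; y] by rewrite /= !inE negb_or xs xy sy.
    move=> /uniq_leq_size le3.
    have : 3 <= size t by apply: le3 => w; rewrite !inE => /or3P [] /eqP ->.
    by rewrite size_tuple leqNgt ltnS hL.
  pose c := map_tuple (fun x => x == y) t.
  have tc : map_tuple (fun b : bool => if b then y else val s) c = t.
    apply: val_inj; rewrite /= -map_comp; apply: map_id_in => x /tP [] -> /=.
      by rewrite (negPf sy).
    by rewrite eqxx.
  have mtc :
      map_tuple (fun b : bool => if b then y else val s') c = map_tuple m t.
    apply: val_inj; rewrite /= -map_comp; apply/eq_in_map => x /tP [] -> /=.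
      by rewrite (negPf sy) /m eqxx.
    by rewrite eqxx /m eq_sym (negPf sy).
  by rewrite -mtc -{1}tc.
(* The default [s] is never taken, since [y] does not occur in [t]. *)
pose t1 := map_tuple (insubd s) t.
pose m1 u := if u == s then s' else u.
have tt1 : t = map_tuple val t1.
  apply: val_inj; rewrite /= -map_comp; apply/esym/map_id_in => x xt /=.
  by rewrite val_insubd !inE (memPn nyt x xt).
have mtt1 : map_tuple m t = map_tuple val (map_tuple m1 t1).
  rewrite tt1; apply: val_inj; rewrite /= -!map_comp; apply: eq_map => x /=.
  by rewrite /m /m1 (inj_eq val_inj); case: eqP.
rewrite mtt1 tt1 -!(@full_hom_val B [set~ y] R).
apply: (full_hom_eq hh); rewrite /= -!map_comp; apply: eq_map => x /=.
by rewrite /m1; case: eqP => // ->.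
Qed.

End Twins.

End FullHom.

Theorem theorem5p1 (L : language)
    (hL : forall R : L, arity R <= 2)
    (A B : structure L)
    (hA : Fcore A) (hB : Fcore B)
    (hgap : Fgap A B) :
  exists v : B, isomorphic A (induced [set~ v]).
Proof.
case: hgap => _ nAB [f hf] gap.
pose C := [set y : B | `[< avoidable A y >]].
have C0 : C != set0.
  (* If no vertex is avoidable, the injective map [f] is also onto, hence an isomorphism. *)
  apply/negP => /eqP C0; apply: nAB; exists f; split=> //.
  have injf := Fcore_full_hom_inj hA hf.
  apply: inj_card_bij => //; rewrite -(card_codom injf).
  apply/subset_leq_card/subsetP => y _; apply: contraT => nfy.
  have : y \in C.
    rewrite inE; apply/asboolP; exists f => // a.
    by apply: contraNneq nfy => <-; apply: codom_f.
  by rewrite C0 inE.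
(* The value at [z] is an equivalence class of [same_type z], so equal values mean that [z] does not
   separate the two vertices. *)
have [y yC sepy] :=
  bondy (fun z u : B => [set v | `[< same_type z u v >]]) C0.
have avy : avoidable A y by move: yC; rewrite inE => /asboolP.
exists y; have cBy : Fcore (induced [set~ y]).
  apply/FcoreP => h hh s s' hss'; apply: contrapT => /eqP nss'.
  have st_eq (z u v : B) : same_type z u v ->
      [set w | `[< same_type z u w >]] = [set w | `[< same_type z v w >]].
    move=> Euv; apply/setP=> w; rewrite !inE.
    apply/asboolP/asboolP => E R c; [rewrite -(Euv R c) | rewrite (Euv R c)];
      exact: E.
  apply: (not_same_type_twin hh hss' hL hB nss').
  have in_C (u v : induced [set~ y]) : h u = h v -> u != v -> val u \in C.
    by move=> huv nuv; rewrite inE; apply/asboolP; apply: (avoidable_twin hh huv).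
  have s'C : val s' \in C by apply: in_C (esym hss') _; rewrite eq_sym.
  have/setP/(_ (val s')) : [set w | `[< same_type y (val s) w >]]
                         = [set w | `[< same_type y (val s') w >]].
    apply: sepy => [|//|z _ zy]; first exact: in_C hss' nss'.
    exact/st_eq/(same_type_twin hh).
  by rewrite !inE => E; apply/asboolP; rewrite E; apply/asboolP.
have lyB : leF (induced [set~ y]) B by exists val; apply: full_hom_val.
case: (gap _ cBy (avoidable_leF avy) lyB) => [/isomorphic_sym // | /isomorphic_card].
rewrite card_sig => cardBy.
have := cardsC1 y; rewrite cardBy => /eqP.
by rewrite eqn_leq leqNgt ltn_predL (cardD1 y).
Qed.
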